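(* Let $G$ be a group of (finite) rank $r$ and let $H\le G$ be a subgroup of finite index with $[G:H]\ge r$. Suppose that each non-trivial divisor (i.e. divisor greater than $1$) of $[G:\operatorname{Core}_G(H)]$ is at least $2r-1$. Then any generating set $S$ of $G$ of size $r$ may be Nielsen-transformed to a set $\tilde S$ that may be extended to a left-right transversal of $H$ in $G$ (that is, $\tilde S$ is contained in a left-right transversal of $H$ in $G$).
   Context: The rank of a finitely generated group $G$ is the smallest size of a generating set of $G$. The core of $H$ in $G$ is $\operatorname{Core}_G(H)=\bigcap_{g\in G} gHg^{-1}$; it has finite index in $G$ when $H$ does. A left (resp. right) transversal of $H$ in $G$ is a set containing exactly one element of each left coset $gH$ (resp. each right coset $Hg$). A left-right transversal is a set which is simultaneously a left and a right transversal. Given a finite multiset $S$ of elements of $G$, a Nielsen move on $S$ is either (1) replacing some entry $g$ of $S$ by $g^{-1}$, or (2) replacing some entry $g$ of $S$ by $hg$ or $gh$, where $h$ is another entry of $S$ (a different occurrence in the multiset). A Nielsen transformation is a finite sequence of Nielsen moves. *)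

(* Defs.v *)
From Stdlib Require Export Relation_Operators.
From mathcomp Require Export all_boot finmap multiset.
From mathcomp Require Export boolp classical_sets functions cardinality.

Set Implicit Arguments.
Unset Strict Implicit.
Unset Printing Implicit Defensive.

Local Open Scope group_scope.
Local Open Scope classical_set_scope.

Section Subgroups.
Context {G : groupType}.
Implicit Types (A H T : set G) (S : {fset G}).

Definition subgroup H := group_closed [in H].

Definition generated A : set G := smallest subgroup A.

Definition generating S := generated [set` S] = [set: G].

Definition has_rank (r : nat) :=
  (exists2 S, generating S & #|` S| = r) /\
  (forall S, generating S -> r <= #|` S|).

Definition left_coset (g : G) H := [set g * h | h in H].
Definition right_coset H (g : G) := [set h * g | h in H].

Definition left_cosets H : set (set G) := [set left_coset g H | g in [set: G]].
Definition right_cosets H : set (set G) := [set right_coset H g | g in [set: G]].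

(* Meaningful for subgroups of finite index only: [fset_set] sends every
   infinite set to [fset0], so the index is 0 otherwise. *)
Definition indexG H : nat := #|` fset_set (left_cosets H)|.

Definition core H : set G := \bigcap_(g in [set: G]) [set g * h * g^-1 | h in H].

Definition left_transversal H T :=
  forall C, left_cosets H C -> exists! t, (T `&` C) t.

Definition right_transversal H T :=
  forall C, right_cosets H C -> exists! t, (T `&` C) t.

Definition left_right_transversal H T :=
  left_transversal H T /\ right_transversal H T.

End Subgroups.

Arguments has_rank : clear implicits.

Section Nielsen.
Context {G : groupType}.
Local Open Scope mset_scope.

(* [x +` M] adds one occurrence of [x] to [M], so [g] and [h] below are
   different occurrences, possibly of the same element. *)
Inductive nielsen_move : {mset G} -> {mset G} -> Prop :=
| NielsenInv g M : nielsen_move (g +` M) (g^-1 +` M)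
| NielsenMull g h M : nielsen_move (g +` (h +` M)) (h * g +` (h +` M))
| NielsenMulr g h M : nielsen_move (g +` (h +` M)) (g * h +` (h +` M)).

Definition nielsen_transformation : {mset G} -> {mset G} -> Prop :=
  clos_refl_trans {mset G} nielsen_move.

End Nielsen.

(* Main.v *)
(* A family extends to a left-right transversal of H as soon as its members lie
   in distinct left cosets and in distinct right cosets of H: in the finite
   quotient of G by the core of H, each double coset of H contains as many left
   as right cosets, and each of these left cosets meets each of these right
   cosets.  By Bezout, the condition on divisors gives a^m notin H whenever a
   notin H and 0 < m < 2r-1.  Fix such an a in S and treat the other entries x
   one by one.  If x shares a coset of H with an entry y already treated, one of
   y^-1 x, x y^-1 lies in H, so x may be assumed to lie in H.  Then the elements
   a^k x, 0 <= k < 2r-1, lie in distinct left and distinct right cosets, and the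
   at most r-1 treated entries exclude at most 2(r-1) values of k. *)
From mathcomp Require Import all_fingroup cyclic.
Require Import Defs.
Set Implicit Arguments.
Unset Strict Implicit.
Unset Printing Implicit Defensive.

(** * Left-right transversals in a finite group *)

Section FiniteGroup.
Import fintype boot.finset.
Local Open Scope group_scope.
Variables (gT : finGroupType) (Q B : {group gT}).
Implicit Types A : {set gT}.

(** The two memberships say that [x] and [y] share a left, respectively a right, coset of [B]. *)
Definition partial_lr_transversal A :=
  (A \subset Q) &&
  [forall x in A, forall y in A,
     (x^-1 * y \in B) || (x * y^-1 \in B) ==> (x == y)].

Lemma partial_lr_transversalP A :
  reflect (A \subset Q /\ {in A &, forall x y,
             (x^-1 * y \in B) || (x * y^-1 \in B) -> x = y})
          (partial_lr_transversal A).
Proof.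
apply: (iffP andP) => -[sAQ HA]; split=> //.
  move=> x y Ax Ay h; move/forall_inP: HA => /(_ x Ax) /forall_inP /(_ y Ay).
  by move/implyP/(_ h)/eqP.
apply/forall_inP=> x Ax; apply/forall_inP=> y Ay.
by apply/implyP=> /(HA _ _ Ax Ay)/eqP.
Qed.

(** Multiplication is injective on pairs: [x * b = y * c] puts [x] and [y] in one left coset. *)
Lemma card_mul_distinct_lcosets A :
  {in A &, forall x y, x^-1 * y \in B -> x = y} -> #|A * B| = (#|A| * #|B|)%N.
Proof.
move=> HA; rewrite -cardsX (curry_imset2X _ A B : A * B = _) card_in_imset // => -[x b] [y c].
rewrite !inE /= => /andP[Ax Bb] /andP[Ay Bc] e.
have xy : x = y.
  apply: HA => //; have -> : y = x * b * c^-1 by rewrite e mulgK.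
  by rewrite -mulgA mulKg groupM ?groupV.
by move: e; rewrite -xy => /mulgI ->.
Qed.

(** Inversion exchanges left and right cosets. *)
Lemma card_mul_distinct_rcosets A :
  {in A &, forall x y, x * y^-1 \in B -> x = y} -> #|B * A| = (#|A| * #|B|)%N.
Proof.
move=> HA; rewrite -cardsX -card_invg.
have -> : (B * A)^-1 = A^-1 * B by rewrite invMg invGid.
rewrite card_mul_distinct_lcosets ?card_invg ?cardsX // => x y Ax Ay.
move=> h; apply: invg_inj; apply: HA; rewrite ?inE -?mem_invg //.
by rewrite invgK.
Qed.

Lemma max_partial_lr_transversal_left A :
  B \subset Q -> maxset partial_lr_transversal A -> A * B = Q.
Proof.
move=> sBQ /maxsetP [/partial_lr_transversalP [sAQ HA] maxA].
have HAl x y : x \in A -> y \in A -> x^-1 * y \in B -> x = y.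
  by move=> Ax Ay h; apply: HA => //; rewrite h.
have HAr x y : x \in A -> y \in A -> x * y^-1 \in B -> x = y.
  by move=> Ax Ay h; apply: HA => //; rewrite h orbT.
apply/eqP; rewrite eqEsubset mul_subG //=; apply/subsetP=> g Qg.
apply/idPn => gNAB.
(* In the double coset of [g], the left and the right cosets met by [A] are
   equally many and of equal size: if [g * B] is missed, so is a right coset. *)
pose D := B * [set g] * B.
pose A' := A :&: D.
have DB : D * B = D by rewrite /D -mulgA mulGid.
have BD : B * D = D by rewrite /D !mulgA mulGid.
have sA'B : A' * B \subset D by rewrite -DB mulSg // subsetIr.
have sBA' : B * A' \subset D by rewrite -BD mulgS // subsetIr.
have Dg : g \in D.
  by rewrite -[g]mulg1 -[g]mul1g /D !mem_mulg ?set11 ?group1.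
have ltD : #|A' * B| < #|D|.
  apply: proper_card; rewrite properE sA'B; apply/subsetPn; exists g => //.
  by apply: contra gNAB; apply: subsetP; rewrite mulSg // subsetIl.
(* An element of [D] outside [B * A'] is [h1 * g * h2]; dropping [h1] keeps its right coset, so
   [z = g * h2] lies in a missed left coset and in a missed right coset. *)
have [z [h [Bh zg zND]]] :
    exists z h, [/\ h \in B, z = g * h & z \notin B * A'].
  have : ~~ (D \subset B * A').
    apply: contraTN ltD => /subset_leq_card; rewrite -leqNgt => /leq_trans; apply.
    rewrite card_mul_distinct_rcosets ?card_mul_distinct_lcosets // => x y.
      by move=> /setIP[Ax _] /setIP[Ay _]; apply: HAl.
    by move=> /setIP[Ax _] /setIP[Ay _]; apply: HAr.
  case/subsetPn => _ /mulsgP [_ h2 /mulsgP [h1 _ Bh1 /set1P -> ->] Bh2 ->] N.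
  exists (g * h2), h2; split=> //; apply: contra N => /mulsgP [b a Bb A'a e].
  by rewrite -mulgA e mulgA mem_mulg ?groupM.
have zNAB : z \notin A * B.
  apply: contra gNAB => /mulsgP [a b Aa Bb e]; rewrite -[g](mulgK h) -zg e.
  by rewrite -mulgA mem_mulg ?groupM ?groupV.
have Dz : z \in D.
  by rewrite zg -[g]mul1g /D !mem_mulg ?set11 ?group1.
have zNBA : z \notin B * A.
  apply: contra zND => /mulsgP [b a Bb Aa e]; rewrite e mem_mulg // inE Aa.
  have -> : a = b^-1 * z by rewrite e mulKg.
  by rewrite -BD mem_mulg ?groupV.
(* Since [z] shares no coset with [A], maximality forces [z] into [A], a contradiction. *)
have zA : z \in A; last by rewrite -[z]mulg1 mem_mulg in zNAB.
rewrite -[A](maxA (z |: A)) ?setU11 ?subsetUr //.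
have Nz x : x \in A -> (x^-1 * z \notin B) * (x * z^-1 \notin B).
  move=> Ax; split.
    by apply: contra zNAB => xz; rewrite -(mulKVg x z) mem_mulg.
  apply: contra zNBA; rewrite -groupV invMg invgK => zx.
  by rewrite -(mulgKV x z) mem_mulg.
apply/partial_lr_transversalP; split.
  by rewrite subUset sub1set sAQ andbT zg groupM ?(subsetP sBQ _ Bh).
move=> x y /setU1P [->|Ax] /setU1P [->|Ay] //.
- rewrite -(groupV B (z^-1 * _)) -(groupV B (z * _)) !invMg !invgK.
  by rewrite !(negbTE (Nz _ Ay).1) (negbTE (Nz _ Ay).2).
- by rewrite !(negbTE (Nz _ Ax).1) (negbTE (Nz _ Ax).2).
- exact: HA.
Qed.

(** By counting, [B * A] has as many elements as [A * B = Q]. *)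
Lemma max_partial_lr_transversal_right A :
  B \subset Q -> maxset partial_lr_transversal A -> B * A = Q.
Proof.
move=> sBQ maxA; have := max_partial_lr_transversal_left sBQ maxA => defQ.
have /maxsetP [/partial_lr_transversalP [sAQ HA] _] := maxA.
apply/eqP; rewrite eqEcard mul_subG //= -defQ.
rewrite card_mul_distinct_lcosets ?card_mul_distinct_rcosets // => x y Ax Ay h.
  by apply: HA => //; rewrite h orbT.
by apply: HA => //; rewrite h.
Qed.
End FiniteGroup.

(** * Cosets, the core and the finite quotient by it *)

Section Cosets.
Local Open Scope group_scope.
Local Open Scope classical_set_scope.
Context {G : groupType}.
Implicit Types (g x : G) (A C H : set G).

Lemma left_cosetE g A x : left_coset g A x = A (g^-1 * x).
Proof.
apply/propext; split=> [[h Ah <-]|Ax]; first by rewrite mulKg.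
by exists (g^-1 * x); rewrite ?mulVKg.
Qed.

Lemma right_cosetE A g x : right_coset A g x = A (x * g^-1).
Proof.
apply/propext; split=> [[h Ah <-]|Ax]; first by rewrite mulgK.
by exists (x * g^-1); rewrite ?mulgVK.
Qed.

Lemma left_cosetM g h A : left_coset (g * h) A = left_coset g (left_coset h A).
Proof. by apply/seteqP; split=> x; rewrite !left_cosetE invgM mulgA. Qed.

Lemma left_coset1 A : left_coset 1 A = A.
Proof. by apply/seteqP; split=> x; rewrite left_cosetE invg1 mul1g. Qed.

Lemma coreE H x : core H x = forall g, H (g^-1 * x * g).
Proof.
apply/propext; split=> [Kx g|Kx g _].
  by have [h Hh <-] := Kx g I; rewrite -!mulgA mulVg mulg1 mulKg.
by exists (g^-1 * x * g); rewrite // mulgA mulgK mulVKg.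
Qed.

Section Subgroup.
Variables (H : set G) (subH : subgroup H).

Lemma subgroup1 : H 1.
Proof. by have [/set_mem] := subH. Qed.

Lemma subgroupM x y : H x -> H y -> H (x * y).
Proof. by move=> /mem_set Hx /mem_set Hy; apply/set_mem/(group_closedM subH). Qed.

Lemma subgroupV x : H x -> H x^-1.
Proof. by move=> /mem_set Hx; apply/set_mem/(group_closedV subH). Qed.

Lemma subgroupVE x : H x^-1 = H x.
Proof. by apply/propext; split=> /subgroupV; rewrite ?invgK. Qed.

Lemma subgroupMl x y : H x -> H (x * y) = H y.
Proof.
move=> Hx; apply/propext; split=> [Hxy|]; last exact: subgroupM.
by rewrite -(mulKg x y); apply/subgroupM/Hxy/subgroupV.
Qed.

Lemma subgroupMr x y : H y -> H (x * y) = H x.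
Proof.
by move=> Hy; rewrite -subgroupVE invgM subgroupMl ?subgroupVE.
Qed.

Lemma subgroupX x n : H x -> H (x ^+ n).
Proof.
move=> Hx; elim: n => [|n IHn]; first exact: subgroup1.
by rewrite expgS; apply: subgroupM.
Qed.

Lemma core_sub : core H `<=` H.
Proof. by move=> x; rewrite coreE => /(_ 1); rewrite invg1 mul1g mulg1. Qed.

Lemma eq_left_coset g h : left_coset g H = left_coset h H <-> H (g^-1 * h).
Proof.
split=> [e|Hgh].
  by rewrite -left_cosetE e left_cosetE mulVg; apply: subgroup1.
apply/seteqP; split=> x; rewrite !left_cosetE.
  by move=> Hx; rewrite -(mulVKg g x) mulgA subgroupMl // -subgroupVE invgM invgK.
by move=> Hx; rewrite -(mulVKg h x) mulgA subgroupMl.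
Qed.
End Subgroup.

Lemma subgroup_core H : subgroup H -> subgroup (core H).
Proof.
move=> subH; split; rewrite ?inE.
  by rewrite coreE => g; rewrite mulg1 mulVg; apply: subgroup1.
move=> x y /set_mem; rewrite coreE => Kx /set_mem; rewrite coreE => Ky.
apply/mem_set; rewrite coreE => g.
have := subgroupM subH (Kx g) (subgroupV subH (Ky g)).
by rewrite !invgM invgK !mulgA mulgK.
Qed.

Section CosetAction.
Variables (H : set G) (subH : subgroup H) (finH : finite_set (left_cosets H)).
Local Notation X := (fset_set (left_cosets H)).

Lemma coset_act_subproof g (C : X) : left_coset g (fsval C) \in X.
Proof.
have := fsvalP C; rewrite !in_fset_set // !inE => -[h _ <-].
by exists (g * h); rewrite ?left_cosetM.
Qed.

Definition coset_act g (C : X) : X := FSetSub (coset_act_subproof g C).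

Lemma coset_act_inj g : injective (coset_act g).
Proof.
move=> C D /(congr1 val) /= e; apply: val_inj => /=.
by rewrite -[LHS]left_coset1 -(mulVg g) left_cosetM e -left_cosetM mulVg left_coset1.
Qed.

(* Permutations compose from left to right, hence the inverse. *)
Definition coset_perm g : {perm X} := perm (@coset_act_inj g^-1).

Lemma coset_permM : {morph coset_perm : x y / x * y}.
Proof.
move=> x y; apply/perm.permP=> C; rewrite permM !permE; apply: val_inj => /=.
by rewrite invgM left_cosetM.
Qed.

(** The coset of [g] is fixed exactly when [x] lies in the conjugate of [H] by [g]. *)
Lemma coset_perm1 x : coset_perm x = 1 <-> core H x.
Proof.
rewrite coreE; split=> [fx1 g|Kx].
  have Xg : left_coset g H \in X by rewrite in_fset_set // inE; exists g.
  move/perm.permP/(_ (FSetSub Xg)): fx1; rewrite perm1 permE => /(congr1 val) /=.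
  by rewrite -left_cosetM => /(eq_left_coset subH); rewrite invgM invgK.
apply/perm.permP=> C; rewrite perm1 permE; apply: val_inj => /=.
have := fsvalP C; rewrite in_fset_set // inE => -[g _ <-].
by rewrite -left_cosetM; apply/(eq_left_coset subH); rewrite invgM invgK.
Qed.

(* [Q] is the quotient of [G] by the core of [H], [B] the image of [H]. *)
Lemma finite_core_quotient :
  exists (gT : finGroupType) (f : G -> gT) (Q B : {group gT}),
    [/\ {morph f : x y / x * y}, B \subset Q,
        forall y, y \in Q <-> exists x, f x = y,
        forall x, f x \in B <-> H x
      & #|Q| = indexG (core H)].
Proof.
pose f := coset_perm; have fM : {morph f : x y / x * y} := coset_permM.
have f1 : f 1 = 1 by apply/coset_perm1; exact: subgroup1 (subgroup_core subH).
have fV (x : G) : f x^-1 = (f x)^-1.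
  by apply: (mulgI (f x)); rewrite -fM !mulgV.
pose Q0 := [set y | `[< exists x, f x = y >]]%SET.
pose B0 := [set y | `[< exists2 x, H x & f x = y >]]%SET.
have Q0P y : y \in Q0 <-> exists x, f x = y.
  by rewrite finset.in_set; split=> /asboolP.
have B0P y : y \in B0 <-> exists2 x, H x & f x = y.
  by rewrite finset.in_set; split=> /asboolP.
have gQ : group_set Q0.
  apply/group_setP; split; first by apply/Q0P; exists 1.
  by move=> _ _ /Q0P [x <-] /Q0P [y <-]; apply/Q0P; exists (x * y).
have gB : group_set B0.
  apply/group_setP; split; first by apply/B0P; exists 1; first exact: subgroup1.
  move=> _ _ /B0P [x Hx <-] /B0P [y Hy <-].
  by apply/B0P; exists (x * y); first exact: subgroupM.
have fker x y : f x = f y <-> core H (x^-1 * y).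
  rewrite -coset_perm1 -/f fM fV; split=> [->|]; first by rewrite mulVg.
  by move/(canRL (mulKVg _)); rewrite mulg1.
exists _, f, (group gQ), (group gB); split=> //.
- by apply/fintype.subsetP=> y /B0P [x _ fx]; apply/Q0P; exists x.
- move=> x; split=> [/B0P [h Hh /fker Khx]|Hx]; last by apply/B0P; exists x.
  by rewrite -(subgroupMl subH _ (subgroupV subH Hh)); apply: core_sub.
rewrite /indexG.
(* The cosets of the core are the fibres of [f] over [Q0]; so they are finitely many and [indexG]
   does not take its default value 0. *)
have -> : left_cosets (core H) = (fun y => f @^-1` [set y]) @` [set` Q0].
  have fibre g : left_coset g (core H) = f @^-1` [set f g].
    by apply/seteqP; split=> x /=; rewrite left_cosetE; [move=> /fker|move=> /esym /fker].
  apply/seteqP; split=> [_ [g _ <-]|_ [y /Q0P [g <-] <-]].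
    by exists (f g) => //=; apply/Q0P; exists g.
  by exists g.
have finQ0 : finite_set [set` Q0] by exact: finite_finset.
rewrite (fset_set_image _ finQ0) card_in_imfset /=.
  have -> : fset_set [set` Q0] = [fset y in Q0]%fset.
    by apply/fsetP=> y; rewrite in_fset_set // mem_setE in_fset.
  by rewrite card_imfset //= -cardE.
move=> y z; rewrite !in_fset_set // => /set_mem /Q0P [g <-] _ e.
by have : (f @^-1` [set f g]) g by []; rewrite e.
Qed.
End CosetAction.
End Cosets.

(** * Choosing an exponent by counting *)

Lemma exists_avoiding (T : eqType) (P : T -> pred nat) c (p : seq T) (u : seq nat) :
    (forall y, count (P y) u <= c) -> c * size p < size u ->
  exists2 k, k \in u & {in p, forall y, ~~ P y k}.
Proof.
elim: p u => [|y p IHp] u countu.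
  by case: u {countu} => // k u _; exists k; rewrite ?mem_head.
(* Dropping the at most [c] values excluded by [y] leaves more than [c * size p]. *)
rewrite /= mulnS => ltu; have [||k] := IHp [seq k <- u | ~~ P y k].
- move=> z; apply: leq_trans (countu z); rewrite count_filter.
  by apply: sub_count => k /andP [].
- rewrite size_filter -(ltn_add2l (count (P y) u)) count_predC.
  by apply: leq_ltn_trans ltu; rewrite leq_add2r.
rewrite mem_filter => /andP [yk ku] kp; exists k => // z.
by rewrite inE => /predU1P [->|/kp].
Qed.

Lemma count_le1 (P : pred nat) u :
    uniq u -> {in u &, forall k l, k < l -> P k -> ~ P l} -> count P u <= 1.
Proof.
move=> uu injP; rewrite -size_filter.
have := filter_uniq P uu; have Pf := mem_filter P.
case e: (filter P u) => [|k [|l v]] //=.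
rewrite inE negb_or => /andP [/andP [kl _] _].
have /andP [Pk ku] : P k && (k \in u) by rewrite -Pf e mem_head.
have /andP [Pl lu] : P l && (l \in u) by rewrite -Pf e !inE eqxx orbT.
case: (ltngtP k l) kl => // kl _; first by case: (injP k l ku lu kl Pk).
by case: (injP l k lu ku kl Pl).
Qed.

(** * Elements in distinct cosets and their extension to a transversal *)

Section Clash.
Local Open Scope group_scope.
Local Open Scope classical_set_scope.
Context {G : groupType}.
Variables (H : set G) (subH : subgroup H).

(** Sharing a left or a right coset of [H]; not transitive in general. *)
Definition clash : rel G := fun x y => (x^-1 * y \in H) || (x * y^-1 \in H).

Lemma clashP x y : reflect (H (x^-1 * y) \/ H (x * y^-1)) (clash x y).
Proof. by apply: (iffP orP); rewrite !inE. Qed.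

Lemma clash_refl : reflexive clash.
Proof. by move=> x; apply/clashP; left; rewrite mulVg; apply: subgroup1. Qed.

Lemma clash_sym : symmetric clash.
Proof.
move=> x y; apply/clashP/clashP => -[] h; [left|right|left|right].
all: by rewrite -subgroupVE // invgM invgK.
Qed.

(** [uniq] allows the multiset of entries to be read as a finite set in the end. *)
Definition distinct_cosets (s : seq G) :=
  uniq s /\ {in s &, forall x y, clash x y -> x = y}.

Lemma distinct_cosets_cons x s :
  {in s, forall y, ~~ clash x y} -> distinct_cosets s -> distinct_cosets (x :: s).
Proof.
move=> xNs [us injs]; split=> [|y z].
  by rewrite /= us andbT; apply/negP=> /xNs; rewrite clash_refl.
rewrite !inE => /predU1P [->|ys] /predU1P [->|zs] //; last exact: injs.
  by rewrite (negbTE (xNs _ zs)).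
by rewrite clash_sym (negbTE (xNs _ ys)).
Qed.

(** The image of [s] in [Q] lies in a maximal partial transversal of [B]; it lifts along a section
    of [f], because [H] is the full preimage of [B]. *)
Lemma extend_to_left_right_transversal (s : seq G) :
  finite_set (left_cosets H) -> distinct_cosets s ->
  exists T, left_right_transversal H T /\ [set` s] `<=` T.
Proof.
move=> finH [_ injs].
have [gT [f [Q [B [fM sBQ QP BP _]]]]] := finite_core_quotient subH finH.
have f1 : f 1 = 1 by apply: (mulgI (f 1)); rewrite -fM !mulg1.
have fV x : f x^-1 = (f x)^-1 by apply: (mulgI (f x)); rewrite -fM !mulgV.
have partial_s : partial_lr_transversal Q B [set y in map f s]%SET.
  apply/partial_lr_transversalP; split.
    apply/fintype.subsetP=> y; rewrite finset.in_set => /mapP [x _ ->].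
    by apply/QP; exists x.
  move=> y z; rewrite !finset.in_set => /mapP [x xs ->] /mapP [w ws ->].
  rewrite -!fV -!fM => h; congr f; apply: injs => //; apply/clashP.
  by case/orP: h => /BP; [left|right].
have [A maxA /fintype.subsetP sA] := maxset_exists partial_s.
have AB := max_partial_lr_transversal_left sBQ maxA.
have BA := max_partial_lr_transversal_right sBQ maxA.
have /maxsetP [/partial_lr_transversalP [/fintype.subsetP sAQ injA] _] := maxA.
(* A section of [f], with values in [s] wherever possible. *)
pose lift y := [set g | f g = y /\ ((exists2 x, x \in s & f x = y) -> g \in s)].
pose t y := xget 1 (lift y).
have tP y : y \in Q -> lift y (t y).
  move=> /QP [x fx]; apply: xgetPex.
  have [[z zs fz]|] := pselect (exists2 x, x \in s & f x = y); first by exists z.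
  by exists x.
(* Entries of [s] with the same image under [f] share a coset of [H], hence coincide. *)
have ts x : x \in s -> t (f x) = x.
  move=> xs; have /tP [ftx tfs] : f x \in Q by apply/QP; exists x.
  apply: injs => //; first by apply: tfs; exists x.
  by apply/clashP; left; apply/BP; rewrite fM fV ftx mulVg group1.
pose T := [set g | f g \in A /\ t (f g) = g].
have injT x y : T x -> T y -> clash x y -> x = y.
  move=> [Ax tx] [Ay ty] /clashP xy; rewrite -tx -ty; congr t; apply: injA => //.
  by case: xy => /BP; rewrite fM fV => ->; rewrite ?orbT.
exists T; split; last first.
  by move=> x xs; split; [apply/sA; rewrite finset.in_set map_f|apply: ts].
(* Existence comes from [A * B = Q], then from [B * A = Q]; uniqueness from [injT]. *)
split=> _ [g _ <-].
  have : f g \in A * B by rewrite AB; apply/QP; exists g.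
  case/mulsgP => a b Aa Bb fg; have [fta _] := tP _ (sAQ _ Aa).
  have Cta : H (g^-1 * t a) by apply/BP; rewrite fM fV fg fta invgM mulgVK groupV.
  exists (t a); split=> [|x [Tx]]; rewrite ?left_cosetE.
    by split; rewrite ?left_cosetE // /T /= fta.
  move=> Cx; apply: injT => //; first by rewrite /T /= fta.
  apply/clashP; left; rewrite -(mulKVg g x) mulgA subgroupMr //.
  by rewrite -subgroupVE // invgM invgK.
have : f g \in B * A by rewrite BA; apply/QP; exists g.
case/mulsgP => b a Bb Aa fg; have [fta _] := tP _ (sAQ _ Aa).
have Cta : H (t a * g^-1) by apply/BP; rewrite fM fV fg fta invgM mulVKg groupV.
exists (t a); split=> [|x [Tx]]; rewrite ?right_cosetE.
  by split; rewrite ?right_cosetE // /T /= fta.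
move=> Cx; apply: injT => //; first by rewrite /T /= fta.
apply/clashP; right; rewrite -(mulgVK g (t a)) -mulgA subgroupMl //.
by rewrite -subgroupVE // invgM invgK.
Qed.

(** Lagrange in the quotient: [f x] to the power [#|Q|] is 1. *)
Lemma index_core_expg x :
  finite_set (left_cosets H) -> H (x ^+ indexG (core H)).
Proof.
move=> finH.
have [gT [f [Q [B [fM sBQ QP BP <-]]]]] := finite_core_quotient subH finH.
have f1 : f 1 = 1 by apply: (mulgI (f 1)); rewrite -fM !mulg1.
have fX n : f (x ^+ n) = f x ^+ n by elim: n => // n IHn; rewrite !expgS fM IHn.
by apply/BP; rewrite fX expg_cardG ?group1 //; apply/QP; exists x.
Qed.

(** Bezout in natural numbers gives [1 + c * m = q * n]; then [x * x ^+ (c * m)] and its second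
    factor both lie in [H]. *)
Lemma coprime_expg_subgroup x m n :
  0 < n -> coprime m n -> H (x ^+ m) -> H (x ^+ n) -> H x.
Proof.
move=> n_gt0 /eqP comn Hm Hn; have [c _] := Bezoutr m n_gt0; rewrite comn.
case/dvdnP=> q e; have := subgroupX subH q Hn.
rewrite -expgnA mulnC -e expgnDr expg1 mulnC expgnA.
by rewrite subgroupMr //; apply: subgroupX.
Qed.

(** Each [y] in [p] excludes at most one [k < N] through left cosets and one through right cosets:
    two exponents [k < l] would put [a ^+ (l - k)] in [H]. *)
Lemma distinct_translates a x N (p : seq G) :
    (forall m, 0 < m < N -> ~ H (a ^+ m)) -> H x -> 2 * size p < N ->
  exists k, {in p, forall y, ~~ clash (a ^+ k * x) y}.
Proof.
move=> aH Hx szp.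
suff [k _ kp] : exists2 k, k \in iota 0 N &
    {in p, forall y, ~~ clash (a ^+ k * x) y} by exists k.
have aHB k l : l \in iota 0 N -> k < l -> ~ H (a ^+ (l - k)).
  rewrite mem_iota add0n => lN kl; apply: aH.
  by rewrite subn_gt0 kl (leq_ltn_trans (leq_subr _ _)).
apply: (exists_avoiding (P := fun y k => clash (a ^+ k * x) y) (c := 2)).
  2: by rewrite size_iota.
move=> y.
pose Pl k := (a ^+ k * x)^-1 * y \in H.
pose Pr k := a ^+ k * x * y^-1 \in H.
rewrite (_ : count _ _ = count (predU Pl Pr) (iota 0 N)) //.
apply: (@leq_trans (count Pl (iota 0 N) + count Pr (iota 0 N))).
  by rewrite -count_predUI leq_addr.
apply: (@leq_add _ _ 1 1); apply: count_le1 (iota_uniq _ _) _ => k l _ lN kl.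
all: rewrite /Pl /Pr !inE => Hk Hl; apply: (aHB k l lN kl).
  (* The product is [x^-1 * a ^+ (l - k) * x], and [x] in [H] removes the conjugation; for right
     cosets it is [a ^+ (l - k)] itself. *)
  have := subgroupM subH Hk (subgroupV subH Hl).
  rewrite -[in a ^+ l](subnKC (ltnW kl)) expgnDr !invgM !invgK !mulgA mulgK mulgVK.
  by rewrite subgroupMr // subgroupMl //; apply: subgroupV.
have := subgroupM subH Hl (subgroupV subH Hk).
rewrite -[in a ^+ l](subnK (ltnW kl)) expgnDr !invgM !invgK !mulgA mulgVK mulgK.
by rewrite mulgK.
Qed.
End Clash.

(** * Nielsen transformations of sequences *)

Section NielsenSeq.
Local Open Scope group_scope.
Context {G : groupType}.
Implicit Types (x y : G) (s t : seq G).

Definition nielsen s t := nielsen_transformation (seq_mset s) (seq_mset t).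

Lemma nielsen_perm s t : perm_eq s t -> nielsen s t.
Proof. by move=> /eq_seq_msetP e; rewrite /nielsen e; apply: rt_refl. Qed.

Lemma nielsen_trans s t u : nielsen s t -> nielsen t u -> nielsen s u.
Proof. exact: rt_trans. Qed.

Lemma nielsen_inv x s : nielsen (x :: s) (x^-1 :: s).
Proof. by rewrite /nielsen !mset_cons; apply/rt_step/NielsenInv. Qed.

Lemma seq_mset_rem y s : y \in s -> seq_mset s = (y +` seq_mset (rem y s))%mset.
Proof. by move=> ys; rewrite -mset_cons; apply/eq_seq_msetP/perm_to_rem. Qed.

Lemma nielsen_mull x y s : y \in s -> nielsen (x :: s) (y * x :: s).
Proof.
move=> ys; rewrite /nielsen !mset_cons (seq_mset_rem ys).
exact/rt_step/NielsenMull.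
Qed.

Lemma nielsen_mulr x y s : y \in s -> nielsen (x :: s) (x * y :: s).
Proof.
move=> ys; rewrite /nielsen !mset_cons (seq_mset_rem ys).
exact/rt_step/NielsenMulr.
Qed.

(** Invert [x], multiply by [y] on the other side, invert again. *)
Lemma nielsen_mulVl x y s : y \in s -> nielsen (x :: s) (y^-1 * x :: s).
Proof.
move=> ys; apply: nielsen_trans (nielsen_inv _ _) _.
apply: nielsen_trans (nielsen_mulr _ ys) _.
by have := nielsen_inv (x^-1 * y) s; rewrite invgM invgK.
Qed.

Lemma nielsen_mulVr x y s : y \in s -> nielsen (x :: s) (x * y^-1 :: s).
Proof.
move=> ys; apply: nielsen_trans (nielsen_inv _ _) _.
apply: nielsen_trans (nielsen_mull _ ys) _.
by have := nielsen_inv (y * x^-1) s; rewrite invgM invgK.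
Qed.

Lemma nielsen_mulXl x y s k : y \in s -> nielsen (x :: s) (y ^+ k * x :: s).
Proof.
move=> ys; elim: k => [|k IHk]; first by rewrite mul1g; apply: nielsen_perm.
by apply: nielsen_trans IHk _; rewrite expgS -mulgA; apply: nielsen_mull.
Qed.

Variables (H : set G) (subH : subgroup H).

(** Induction on the untreated entries [q]: the total size is constant, and [a] stays in the treated
    part [p], available as a multiplier. *)
Lemma nielsen_distinct_cosets a N (p q : seq G) :
    (forall m, 0 < m < N -> ~ H (a ^+ m)) -> a \in p ->
    2 * (size p + size q) <= N.+1 -> distinct_cosets H p ->
  exists2 s, nielsen (q ++ p) s & distinct_cosets H s.
Proof.
move=> aH; elim: q p => [|x q IHq] p ap szN dp.
  by exists p; first exact: nielsen_perm.
suff [z nz zNp] : exists2 z, nielsen (x :: q ++ p) (z :: q ++ p)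
                           & {in p, forall y, ~~ clash H z y}.
  have [||s ns ds] := IHq (z :: p) _ _ (distinct_cosets_cons subH zNp dp).
  - by rewrite inE ap orbT.
  - by rewrite addSnnS.
  exists s => //; apply: nielsen_trans nz (nielsen_trans _ ns).
  by apply: nielsen_perm; rewrite -cat1s -[z :: p]cat1s perm_catCA.
have sub_p y : y \in p -> y \in q ++ p by rewrite mem_cat orbC => ->.
have [z nz [Hz|zNp]] : exists2 z, nielsen (x :: q ++ p) (z :: q ++ p)
    & H z \/ {in p, forall y, ~~ clash H z y}.
- have [/hasP [y yp /clashP [Hxy|Hxy]]|/hasPn xNp] := boolP (has (clash H x) p).
  + exists (y^-1 * x); first exact/nielsen_mulVl/sub_p.
    by left; rewrite -subgroupVE // invgM invgK.
  + by exists (x * y^-1); [exact/nielsen_mulVr/sub_p|left].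
  + by exists x; [exact: nielsen_perm|right].
(* The entry in hand counts in the size bound, so [2 * (size p).+1 <= N.+1], whence
   [2 * size p < N]. *)
- have [|k kp] := @distinct_translates _ _ subH a z N p aH Hz.
    move: szN; rewrite /= addnS mulnS !addSn ltnS; apply: leq_trans.
    by rewrite ltnS leq_mul2l leq_addr.
  exists (a ^+ k * z) => //.
  by apply: nielsen_trans nz _; apply/nielsen_mulXl/sub_p.
- by exists z.
Qed.
End NielsenSeq.

(** * The multiplier outside [H] and the conclusion *)

Local Open Scope classical_set_scope.

(** Otherwise [H] contains the subgroup generated by [S], so it is [G] and has index 1. *)
Lemma generating_not_sub (G : groupType) (H : set G) (S : {fset G}) :
    subgroup H -> generating S -> 1 < indexG H ->
  exists2 a, a \in S & ~ H a.
Proof.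
move=> subH genS; apply: contraPP => SH.
have HT : H = setT.
  apply/seteqP; split=> // x _; have : generated [set` S] x by rewrite genS.
  apply; split=> // a aS; have [//|nHa] := pselect (H a).
  by case: SH; exists a.
rewrite /indexG.
have -> : left_cosets H = [set H].
  have cosetT g : left_coset g H = H.
    by apply/seteqP; split=> x; rewrite left_cosetE HT.
  apply/seteqP; split=> [_ [g _ <-] //=|_ ->].
  by exists 1%g.
by rewrite fset_set1 cardfs1.
Qed.

(** The gcd of [m] and the index of the core divides that index and is below [n], hence is 1; with
    [a ^+ m] in [H], coprimality would put [a] in [H]. *)
Lemma coset_expg_notin (G : groupType) (H : set G) n a :
    subgroup H -> finite_set (left_cosets H) ->
    (forall d : nat, d %| indexG (core H) -> 1 < d -> n <= d) ->
    0 < indexG (core H) -> ~ H a ->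
  forall m, 0 < m < n -> ~ H (a ^+ m)%g.
Proof.
move=> subH finH divs idx_gt0 nHa m /andP [m_gt0 ltmn] Ham; apply: nHa.
apply: (coprime_expg_subgroup subH idx_gt0 _ Ham (index_core_expg subH a finH)).
have g_gt0 : 0 < gcdn m (indexG (core H)) by rewrite gcdn_gt0 m_gt0.
rewrite /coprime eqn_leq g_gt0 andbT leqNgt; apply/negP=> /(divs _ (dvdn_gcdr _ _)).
by rewrite leqNgt (leq_ltn_trans _ ltmn) // dvdn_leq // dvdn_gcdl.
Qed.

Theorem theorem1p5 (G : groupType) (r : nat) (H : set G)
    (rankG : has_rank G r) (subH : subgroup H)
    (finH : finite_set (left_cosets H)) (le_r_indexH : r <= indexG H)
    (divisors_core : forall d : nat,
       d %| indexG (core H) -> 1 < d -> 2 * r - 1 <= d)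
    (S : {fset G}) (genS : generating S) (cardS : #|` S| = r) :
  exists St : {fset G},
    nielsen_transformation (seq_mset S) (seq_mset St) /\
    exists T : set G, left_right_transversal H T /\ [set` St] `<=` T.
Proof.
suff [s nSs ds] : exists2 s, nielsen S s & distinct_cosets H s.
  have [T [lrT sT]] := extend_to_left_right_transversal subH finH ds.
  exists [fset x in s]%fset; split; last first.
    by exists T; split=> // x /=; rewrite in_fset => /sT.
  apply: nielsen_trans nSs (nielsen_perm _); case: ds => us _.
  by apply: uniq_perm => [||x]; rewrite ?fset_uniq ?in_fset.
(* For [r <= 1] possibly [H = G], but then [S] has at most one entry and no move is made. *)
have [r_gt1|r_le1] := ltnP 1 r; last first.
  exists S; first exact: nielsen_perm.
  split=> [|x y]; first exact: fset_uniq.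
  rewrite -cardS in r_le1.
  case: (enum_fset S) r_le1 => [|z [|]] //= _.
  by rewrite !inE => /eqP -> /eqP ->.
have [a aS nHa] := generating_not_sub subH genS (leq_trans r_gt1 le_r_indexH).
(* If the index were 0, then 2 would divide it, yet [2 < 2 * r - 1]. *)
have idx_gt0 : 0 < indexG (core H).
  rewrite lt0n; apply/eqP=> idx0; have := divisors_core 2; rewrite idx0 dvdn0.
  by move=> /(_ isT isT); rewrite leqNgt ltn_subRL (leq_mul2l 2 2) r_gt1.
have aH := coset_expg_notin subH finH divisors_core idx_gt0 nHa.
(* Here [N = 2 * r - 1], and the size bound [2 * (1 + (r - 1)) <= N.+1] is an equality. *)
have [| |s ns ds] := nielsen_distinct_cosets subH aH (mem_head a [::]) (q := rem a S).
- have r_gt0 := ltnW r_gt1; rewrite /= size_rem // cardS add1n prednK //.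
  by rewrite subn1 prednK // muln_gt0.
- by split=> // x y; rewrite !inE => /eqP -> /eqP ->.
exists s => //; apply: nielsen_trans ns; apply: nielsen_perm.
by rewrite cats1 perm_sym perm_rcons perm_sym perm_to_rem.
Qed.
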